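(* Let $N\ge2$ be an integer, $x\in[0,1]\setminus\mathbb{Q}$, and let $\widehat\omega=\widehat\omega(x,N)$ with factor complexity function $p_{\widehat\omega}$. Then for every $n\ge1$, $$p_{\widehat\omega}(n+1)-p_{\widehat\omega}(n)=\begin{cases}1,&\widehat t_{k-1}<n\le\widehat s_k\text{ for some }k\geq 1,\\2,&\widehat s_k<n\le\widehat t_k\text{ for some }k\geq 1.\end{cases}$$
   Context: Let $N\ge 1$ be an integer and define $T_N:[0,1]\to[0,1]$ by $T_N(x)=\frac{N}{x}-\lfloor\frac{N}{x}\rfloor$ for $x\ne0$ and $T_N(0)=0$. For $x\in[0,1]\setminus\mathbb{Q}$ the (greedy) NCF digits of $x$ are $d_n=\lfloor N/T_N^{n-1}(x)\rfloor\ge N$, $n\ge1$; one writes $x=[0;d_1,d_2,\ldots]_N$. Let $\widehat\sigma_n(0)=0^{d_n}1$, $\widehat\sigma_n(1)=0^N$ for $n\ge1$, extended to finite and infinite words over $\{0,1\}$ by concatenation. The dual NCF sequence $\widehat\omega(x,N)$ is the unique $\widehat\omega\in\{0,1\}^{\mathbb{N}}$ for which there exist $\widehat\omega^{(1)},\widehat\omega^{(2)},\ldots\in\{0,1\}^{\mathbb{N}}$ with $\widehat\omega^{(1)}=\widehat\omega$ and $\widehat\omega^{(n)}=\widehat\sigma_n(\widehat\omega^{(n+1)})$ for all $n\ge1$. The factor complexity $p_\nu(n)$ of a sequence $\nu$ is the number of distinct factors (contiguous subwords) of $\nu$ of length $n$. Put $\widehat\Sigma_1=0$, $\widehat\Sigma_{n+1}=\widehat\sigma_1\circ\cdots\circ\widehat\sigma_n(0)$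 for $n\ge1$. For $k\ge1$ let $\widehat S_k=\widehat\Sigma_k^{d_k}\widehat\Sigma_{k-1}^{d_{k-1}}\cdots\widehat\Sigma_1^{d_1}$ and $\widehat T_k=\widehat\Sigma_k^{N-1}\widehat S_k$. With $|\cdot|$ denoting word length, $\widehat s_k=|\widehat S_k|$, $\widehat t_k=|\widehat T_k|$ for $k\ge1$, and $\widehat t_0=0$, so that $\widehat t_0<\widehat s_1<\widehat t_1<\widehat s_2<\cdots$. *)

(* Defs.v *)
From HB Require Import structures.
From mathcomp Require Import all_boot all_order all_algebra.
From mathcomp Require Import all_classical all_reals.

Set Implicit Arguments.
Unset Strict Implicit.
Unset Printing Implicit Defensive.

Import Order.TTheory GRing.Theory Num.Theory.
Local Open Scope ring_scope.

(* Words over {0,1} have type [seq bool], right-infinite words [nat -> bool],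
   with 0 = false and 1 = true.  Families indexed from 1 in the mathematics
   (digits, substitutions, levels of desubstitution) keep that indexing; their
   value at index 0 is never used. *)

Definition ncf_map (R : realType) (N : nat) (x : R) : R :=
  if x == 0 then 0 else N%:R / x - (Num.floor (N%:R / x))%:~R.

(* The floor is nonnegative for [x] in [0,1], where [absz] is the identity. *)
Definition ncf_digit (R : realType) (N : nat) (x : R) (n : nat) : nat :=
  `|Num.floor (N%:R / iter n.-1 (ncf_map N) x)|%N.

Definition pow_word (m : nat) (w : seq bool) : seq bool := flatten (nseq m w).

Definition subst_word (s : bool -> seq bool) (w : seq bool) : seq bool :=
  flatten [seq s a | a <- w].

(* The infinite concatenation s(u_0) s(u_1) ..., for [s] with nonempty images:
   the first i+1 blocks then cover position i. *)
Definition subst_inf (s : bool -> seq bool) (u : nat -> bool) (i : nat) : bool :=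
  nth false (subst_word s (mkseq u i.+1)) i.

Definition dual_sigma (N : nat) (d : nat -> nat) (n : nat) (a : bool)
    : seq bool :=
  if a then nseq N false else rcons (nseq (d n) false) true.

Definition is_dual_seq (N : nat) (d : nat -> nat) (w : nat -> bool) : Prop :=
  exists W : nat -> nat -> bool,
    W 1%N = w /\
    forall n, (1 <= n)%N -> W n = subst_inf (dual_sigma N d n) (W n.+1).

(* [get] picks an element of the set; that the set is a singleton when
   1 <= N and x is an irrational of [0,1] is lemma [dual_ncfP] below. *)
Definition dual_ncf (R : realType) (N : nat) (x : R) : nat -> bool :=
  get [set w : nat -> bool | is_dual_seq N (ncf_digit N x) w]%classic.

Definition is_factor (nu : nat -> bool) (u : seq bool) : Prop :=
  exists i, u = mkseq (fun j => nu (i + j)%N) (size u).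

Definition factor_complexity (nu : nat -> bool) (n : nat) : nat :=
  #|[set u : n.-tuple bool | `[< is_factor nu u >]]|.

(* sigma_1 o ... o sigma_n *)
Fixpoint dual_sigma_comp (N : nat) (d : nat -> nat) (n : nat) (w : seq bool)
    : seq bool :=
  if n is m.+1
  then dual_sigma_comp N d m (subst_word (dual_sigma N d m.+1) w)
  else w.

Definition dual_Sigma (N : nat) (d : nat -> nat) (k : nat) : seq bool :=
  dual_sigma_comp N d k.-1 [:: false].

Fixpoint dual_S (N : nat) (d : nat -> nat) (k : nat) : seq bool :=
  if k is m.+1 then pow_word (d m.+1) (dual_Sigma N d m.+1) ++ dual_S N d m
  else [::].

Definition dual_T (N : nat) (d : nat -> nat) (k : nat) : seq bool :=
  pow_word N.-1 (dual_Sigma N d k) ++ dual_S N d k.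

Definition dual_s (N : nat) (d : nat -> nat) (k : nat) : nat :=
  size (dual_S N d k).

Definition dual_t (N : nat) (d : nat -> nat) (k : nat) : nat :=
  if k is 0 then 0%N else size (dual_T N d k).

Lemma subst_word_cat (s : bool -> seq bool) u v :
  subst_word s (u ++ v) = subst_word s u ++ subst_word s v.
Proof. by rewrite /subst_word map_cat flatten_cat. Qed.

Lemma subst_word_prefix (s : bool -> seq bool) u v :
  prefix u v -> prefix (subst_word s u) (subst_word s v).
Proof. by case/prefixP=> t ->; rewrite subst_word_cat prefix_prefix. Qed.

Lemma size_subst_word (s : bool -> seq bool) w :
  (forall a, 0 < size (s a))%N -> (size w <= size (subst_word s w))%N.
Proof.
move=> s0; elim: w => //= a w IHw.
by rewrite /subst_word /= size_cat -add1n leq_add.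
Qed.

Lemma nth_prefix (u v : seq bool) i :
  prefix u v -> (i < size u)%N -> nth false u i = nth false v i.
Proof. by case/prefixP=> t -> iu; rewrite nth_cat iu. Qed.

Lemma dual_sigma_gt0 N d n a :
  (0 < N)%N -> (0 < size (dual_sigma N d n a))%N.
Proof. by case: a => N0; rewrite /= ?size_nseq ?size_rcons. Qed.

Lemma dual_seq_exists_unique N (d : nat -> nat) :
    (0 < N)%N -> (forall n, 0 < n -> 0 < d n)%N ->
  exists! w, is_dual_seq N d w.
Proof.
move=> N0 d0.
pose sg n := dual_sigma N d n.
have sg0 n a : (0 < size (sg n a))%N by exact: dual_sigma_gt0.
have sgh n a : (0 < n)%N -> nth false (sg n a) 0 = false.
  move=> /d0; rewrite /sg /dual_sigma; case: a; first by rewrite nth_nseq if_same.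
  by case: (d n).
pose fix C n m := if m is m'.+1 then subst_word (sg n) (C n.+1 m') else [:: false].
have CP m n : (0 < n)%N -> (m < size (C n m))%N /\ nth false (C n m) 0 = false.
  elim: m n => // m IHm n n0; rewrite [C n m.+1]/=.
  have [] := IHm n.+1 isT; case: (C n.+1 m) => //= a l ml a0.
  rewrite /subst_word /= nth_cat sg0 sgh//; split=> //.
  rewrite size_cat a0 [sg n false]/= /sg /dual_sigma size_rcons size_nseq.
  rewrite addSn ltnS -add1n leq_add ?d0//.
  by apply: leq_trans (size_subst_word _ (sg0 n)).
have Cs m n : (0 < n)%N -> (m < size (C n m))%N by case/(CP m).
have C0 m n : (0 < n)%N -> nth false (C n m) 0 = false by case/(CP m).
have Cpre m m' n : (0 < n)%N -> (m <= m')%N -> prefix (C n m) (C n m').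
  elim: m m' n => [|m IHm] [|m'] n n0 //=.
    move=> _; have := C0 m'.+1 n n0; have := Cs m'.+1 n n0.
    rewrite -[subst_word _ _]/(C n m'.+1).
    by case: (C n m'.+1) => //= a l _ ->; rewrite eqxx prefix0s.
  by rewrite ltnS => mm; apply/subst_word_prefix/IHm.
pose W n i := nth false (C n i) i.
have WP n : (1 <= n)%N -> W n = subst_inf (sg n) (W n.+1).
  move=> n0; apply/funext => i; rewrite /subst_inf.
  have -> : W n i = nth false (C n i.+1) i.
    by apply: nth_prefix; [exact: Cpre | exact: Cs].
  have -> : mkseq (W n.+1) i.+1 = take i.+1 (C n.+1 i).
    apply: (@eq_from_nth _ false); rewrite size_mkseq.
      by rewrite size_takel ?Cs.
    move=> j ji; rewrite nth_mkseq// nth_take//.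
    by apply: nth_prefix; [exact: Cpre | exact: Cs].
  apply/esym/nth_prefix; first exact/subst_word_prefix/prefix_take.
  apply: leq_trans (size_subst_word _ (sg0 n)).
  by rewrite size_takel ?Cs.
exists (W 1%N); split; first by exists W; split.
move=> w [V [<- VP]].
have key m n j : (0 < n)%N -> (j < size (C n m))%N -> V n j = nth false (C n m) j.
  elim: m n j => [|m IHm] n j n0 jC.
    case: j jC => // _; rewrite VP//= /subst_inf /mkseq /subst_word /=.
    by rewrite cats0 sgh.
  rewrite VP// /subst_inf [C n m.+1]/=.
  have [le|gt] := leqP (size (C n.+1 m)) j.+1.
    apply/esym/nth_prefix; last by [].
    apply/subst_word_prefix/prefixP.
    exists (drop (size (C n.+1 m)) (mkseq (V n.+1) j.+1)).
    rewrite -[LHS](cat_take_drop (size (C n.+1 m))); congr (_ ++ _).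
    have sz : size (take (size (C n.+1 m)) (mkseq (V n.+1) j.+1)) = size (C n.+1 m).
      by rewrite size_takel ?size_mkseq.
    apply: (@eq_from_nth _ false); rewrite sz// => i iC.
    by rewrite nth_take// nth_mkseq ?(leq_trans iC)// IHm.
  have -> : mkseq (V n.+1) j.+1 = take j.+1 (C n.+1 m).
    apply: (@eq_from_nth _ false); rewrite size_mkseq.
      by rewrite size_takel// ltnW.
    move=> i ij; rewrite nth_mkseq// nth_take// IHm//.
    by rewrite (leq_trans ij)// ltnW.
  apply: nth_prefix; first exact/subst_word_prefix/prefix_take.
  apply: leq_trans (size_subst_word _ (sg0 n)).
  by rewrite size_takel// ltnW.
by apply/funext => i; apply/esym/key => //; exact: Cs.
Qed.

Lemma ncf_map_irrational (R : realType) (N : nat) (x : R) :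
    (0 < N)%N -> 0 <= x <= 1 -> irrational x ->
  0 <= ncf_map N x <= 1 /\ irrational (ncf_map N x).
Proof.
move=> N0 x01 xI.
have x0 : x != 0 by apply/eqP => x0; apply: xI; exists 0 => //; rewrite x0 raddf0.
rewrite /ncf_map (negbTE x0); set y := N%:R / x; split.
  by rewrite subr_ge0 Num.Theory.floor_le lerBlDl ltW// -intrD1 floorD1_gt.
move=> [q _ qE]; apply: xI.
have yE : y = ratr (q + (Num.floor y)%:~R).
  by rewrite rmorphD /= qE ratr_int subrK.
exists (N%:R / (q + (Num.floor y)%:~R)) => //.
rewrite fmorph_div /= -yE ratr_nat /y invf_div mulrCA divff ?mulr1//.
by rewrite pnatr_eq0 -lt0n.
Qed.

Lemma ncf_digit_ge (R : realType) (N : nat) (x : R) n :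
  (0 < N)%N -> 0 <= x <= 1 -> irrational x -> (N <= ncf_digit N x n)%N.
Proof.
move=> N0 x01 xI; rewrite /ncf_digit; set y := iter _ _ _.
have [/andP[y0 y1] yI] : 0 <= y <= 1 /\ irrational y.
  rewrite /y; elim: n.-1 => //= m [IH1 IH2]; exact: ncf_map_irrational.
have {}y0 : 0 < y.
  rewrite lt_neqAle y0 andbT; apply/eqP => y00; apply: yI.
  by exists 0 => //; rewrite -y00 raddf0.
have h : N%:Z <= Num.floor (N%:R / y).
  by rewrite floor_ge_int -pmulrn ler_pdivlMr// ler_piMr.
by rewrite -lez_nat gez0_abs// (le_trans _ h).
Qed.

Lemma dual_ncfP (R : realType) (N : nat) (x : R) :
    (0 < N)%N -> 0 <= x <= 1 -> irrational x ->
  unique (is_dual_seq N (ncf_digit N x)) (dual_ncf N x).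
Proof.
move=> N0 x01 xI.
have d0 n : (0 < n -> 0 < ncf_digit N x n)%N.
  by move=> _; exact: leq_trans N0 (ncf_digit_ge _ N0 x01 xI).
have [w [wP wU]] := dual_seq_exists_unique N0 d0.
suff -> : dual_ncf N x = w by split.
by apply: get_unique => // v /wU.
Qed.

(* Main.v *)
(* p(n+1) - p(n) counts the right special factors of length n.  A right special
   factor other than a run of zeros ends in 1 0^{d_1}, and cutting the dual
   sequence into the blocks sigma_1(a) writes it as a suffix of
   sigma_1(z) 0^{d_1} with z a shorter right special factor of the
   desubstituted sequence.  Since T_{k+1} = sigma_1(T_k') 0^{d_1}, with T_k' the
   word of the shifted digits, the right special factors are exactly the
   suffixes of the words T_k.  The words T_k and S_{k+1} both end with S_k and
   the preceding letters differ, so there is a second right special factor of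
   length n exactly when s_k < n <= t_k for some k. *)
Require Import Defs.
From mathcomp Require Import all_boot all_order all_algebra.
From mathcomp Require Import all_classical all_reals.
From mathcomp Require Import zify.

Set Implicit Arguments.
Unset Strict Implicit.
Unset Printing Implicit Defensive.

Import Order.TTheory GRing.Theory Num.Theory.

(** * Right special factors and the growth of factor complexity *)

Definition right_special (w : nat -> bool) (u : seq bool) : Prop :=
  forall a, is_factor w (rcons u a).

Lemma suffix_total (T : eqType) (u v w : seq T) :
  suffix u w -> suffix v w -> size u <= size v -> suffix u v.
Proof.
move=> uw /suffixP[t wE]; move: uw; rewrite {}wE !suffixE size_cat => uw uv.
by rewrite drop_cat ltnNge -addnBA// leq_addr/= addKn in uw.
Qed.

Lemma suffix_eq (T : eqType) (u v y : seq T) : suffix u y -> suffix v y -> size u = size v -> u = v.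
Proof. by rewrite !suffixE => /eqP uE /eqP vE uv; rewrite -uE uv. Qed.

Lemma suffix_tuple (T : eqType) n (v : seq T) : n <= size v -> exists u : n.-tuple T, suffix u v.
Proof.
move=> nv; have sz : size (drop (size v - n) v) == n by rewrite size_drop subKn.
by exists (Tuple sz); exact: suffix_drop.
Qed.

(** Seeing a factor as a suffix of a prefix of [w] turns every later comparison of occurrences into
    a comparison of suffixes. *)
Lemma is_factorP (w : nat -> bool) u :
  is_factor w u <-> exists m, suffix u (mkseq w m).
Proof.
split=> [[i ->]|[m /suffixP[p pE]]].
  exists (i + size u); apply/suffixP; exists (mkseq w i).
  by rewrite /mkseq iotaD map_cat -[0 + i]addn0 iotaDl -map_comp.
exists (size p); have := congr1 size pE; rewrite size_mkseq size_cat => mE.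
apply: (@eq_from_nth _ false); first by rewrite size_mkseq.
move=> i iu; rewrite nth_mkseq//.
have := congr1 (fun s => nth false s (size p + i)) pE.
by rewrite nth_mkseq ?mE ?ltn_add2l// nth_cat ltnNge leq_addr/= addKn => ->.
Qed.

Lemma mkseqSr (w : nat -> bool) m : mkseq w m.+1 = rcons (mkseq w m) (w m).
Proof. by rewrite /mkseq -addn1 iotaD map_cat cats1. Qed.

Lemma is_factor_rconsP (w : nat -> bool) u a :
  is_factor w (rcons u a) <-> exists2 m, suffix u (mkseq w m) & w m = a.
Proof.
rewrite is_factorP; split=> [[[|m]]|[m um <-]].
- by rewrite suffixs0; case: u.
- by rewrite mkseqSr suffix_rcons => /andP[/eqP am um]; exists m.
- by exists m.+1; rewrite mkseqSr suffix_rcons eqxx.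
Qed.

Lemma right_special_suffix (w : nat -> bool) u v :
  suffix u v -> right_special w v -> right_special w u.
Proof.
move=> uv vR a; apply/is_factor_rconsP.
by have /is_factor_rconsP[m vm wm] := vR a; exists m => //; exact: suffix_trans vm.
Qed.

(** With [E a] the words of length [n] that can be followed by [a], the factors of length [n.+1]
    number [|E false| + |E true|]. Every factor of length [n] has some extension, so the union of
    the [E a] counts these factors, and their intersection is the set of right special ones. *)
Lemma factor_complexityS (w : nat -> bool) n :
  factor_complexity w n.+1 =
  factor_complexity w n + #|[set u : n.-tuple bool | `[< right_special w u >]]|.
Proof.
pose E a := [set u : n.-tuple bool | `[< is_factor w (rcons u a) >]]%SET.
have EI : [set u : n.-tuple bool | `[< right_special w u >]]%SET = E false :&: E true.
  apply/setP => u; rewrite !inE; apply/asboolP/andP => [uR|].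
    by split; apply/asboolP; exact: uR.
  by case=> /asboolP u0 /asboolP u1 [].
have EU : [set u : n.-tuple bool | `[< is_factor w u >]]%SET = E false :|: E true.
  apply/setP => u; rewrite !inE; apply/asboolP/orP => [/is_factorP[m um]|].
    by case wm : (w m); [right|left]; apply/asboolP/is_factor_rconsP; exists m.
  by case=> /asboolP/is_factor_rconsP[m um _]; apply/is_factorP; exists m.
have rinj a : injective (fun u : n.-tuple bool => [tuple of rcons u a]).
  by move=> u v /(congr1 val)/= /rcons_inj[/val_inj].
pose F a := [set [tuple of rcons u a] | u : n.-tuple bool in E a]%SET.
have FU : [set u : n.+1.-tuple bool | `[< is_factor w u >]]%SET = F false :|: F true.
  apply/setP => u; rewrite !inE; apply/asboolP/orP => [|].
    case: u => u /= su; case: (lastP u) su => [//|v a] va vaF.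
    have sv : size v == n by move: (va); rewrite size_rcons eqSS.
    have vF : Tuple sv \in E a by rewrite inE; apply/asboolP.
    by case: a va vF {vaF} => va vF; [right|left]; apply/imsetP; exists (Tuple sv) => //;
      apply: val_inj.
  by case=> /imsetP[v]; rewrite inE => /asboolP vF ->.
have FI : F false :&: F true = finset.set0.
  apply/setP => u; rewrite !inE; apply/negP => /andP[/imsetP[v _ ->] /imsetP[v' _]].
  by move=> /(congr1 val)/= /rcons_inj[].
by rewrite /factor_complexity FU EU EI cardsUI cardsU FI cards0 subn0 !card_imset.
Qed.

(** * Substitutions, suffixes and prefixes *)

Lemma subst_word_rcons (s : bool -> seq bool) w a :
  subst_word s (rcons w a) = subst_word s w ++ s a.
Proof. by rewrite -cats1 subst_word_cat /subst_word /= cats0. Qed.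

Lemma subst_word_pow (s : bool -> seq bool) m w :
  subst_word s (pow_word m w) = pow_word m (subst_word s w).
Proof. by elim: m => //= m IHm; rewrite /pow_word /= subst_word_cat IHm. Qed.

Lemma suffix_subst_word (s : bool -> seq bool) u v :
  suffix u v -> suffix (subst_word s u) (subst_word s v).
Proof. by case/suffixP=> t ->; rewrite subst_word_cat suffix_suffix. Qed.

Lemma nth_subst_inf (s : bool -> seq bool) (w : nat -> bool) m i :
    (forall a, 0 < size (s a)) -> i < size (subst_word s (mkseq w m)) ->
  subst_inf s w i = nth false (subst_word s (mkseq w m)) i.
Proof.
move=> s0 im; rewrite /subst_inf.
have pre a b : a <= b -> prefix (subst_word s (mkseq w a)) (subst_word s (mkseq w b)).
  move=> ab; apply: subst_word_prefix; apply/prefixP.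
  exists (map w (iota a (b - a))).
  by rewrite /mkseq -map_cat -{2}[a]add0n -iotaD subnKC.
have [/pre mi|/ltnW/pre im'] := leqP m i.+1; first by rewrite -(nth_prefix mi).
apply: (nth_prefix im'); apply: leq_trans (size_subst_word _ s0).
by rewrite size_mkseq.
Qed.

(* Since s(0) and s(1) end with different letters, a
   common suffix of s(P) and s(Q) cannot extend past the point where P and Q
   differ. *)
Lemma common_suffix_subst (s : bool -> seq bool) x P Q :
    (forall a, 0 < size (s a)) -> (forall a c, last c (s a) = ~~ a) ->
    suffix x (subst_word s P) -> suffix x (subst_word s Q) ->
  exists z, [/\ suffix z P, suffix z Q, suffix x (subst_word s z) & size z <= size x].
Proof.
move=> s0 sl; elim/last_ind: P x Q => [|P a IH] x Q.
  by rewrite suffixs0 => /eqP-> _; exists [::]; rewrite !suffix0s.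
case/lastP: Q => [_|Q b].
  by rewrite suffixs0 => /eqP-> ; exists [::]; rewrite !suffix0s.
rewrite !subst_word_rcons => xP xQ.
have [->|x0] := eqVneq x [::]; first by exists [::]; rewrite !suffix0s.
have lastx c y : suffix x (y ++ s c) -> last false x = ~~ c.
  case/suffixP=> t /(congr1 (last false)); rewrite !last_cat sl => ->.
  by case: x x0 {xP xQ}.
have ab : a = b by apply: negb_inj; rewrite -(lastx _ _ xP) -(lastx _ _ xQ).
rewrite -{b lastx}ab in xQ *.
(* If [x] fits in the last common block, the single letter [a] suffices; otherwise that block is
   stripped and the induction goes on. *)
have [xs|sx] := leqP (size x) (size (s a)).
  exists [:: a]; split.
  - by rewrite -cats1 suffix_suffix.
  - by rewrite -cats1 suffix_suffix.
  - by rewrite /subst_word /= cats0; exact: suffix_total xP (suffix_suffix _ _) xs.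
  - by rewrite lt0n size_eq0.
have [y xE] : exists y, x = y ++ s a.
  by apply/suffixP; exact: suffix_total (suffix_suffix _ _) xP (ltnW sx).
move: xP xQ; rewrite xE !suffix_catl// eqxx /= => yP yQ.
have [z [zP zQ yz zy]] := IH _ _ yP yQ.
exists (rcons z a); split; rewrite ?suffix_rcons ?eqxx//.
  by rewrite subst_word_rcons suffix_catl// eqxx.
by rewrite size_rcons size_cat -addn1 leq_add.
Qed.

Lemma mkseq_subst_inf (s : bool -> seq bool) (w : nat -> bool) m :
    (forall a, 0 < size (s a)) ->
  mkseq (subst_inf s w) (size (subst_word s (mkseq w m))) = subst_word s (mkseq w m).
Proof.
move=> s0; apply: (@eq_from_nth _ false); rewrite size_mkseq// => i im.
by rewrite nth_mkseq// (nth_subst_inf s0 im).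
Qed.

Lemma mkseq_cat_cons (w : nat -> bool) m p a q :
  mkseq w m = p ++ a :: q -> mkseq w (size p) = p /\ w (size p) = a.
Proof.
move=> E; have := congr1 size E; rewrite size_mkseq size_cat /= => mE.
have wE i : i < m -> w i = nth false (p ++ a :: q) i by move=> im; rewrite -E nth_mkseq.
split; last by rewrite wE ?nth_cat ?ltnn ?subnn//; lia.
apply: (@eq_from_nth _ false); rewrite size_mkseq// => i ip.
by rewrite nth_mkseq// wE ?nth_cat ?ip//; lia.
Qed.

(** * Final runs of zeros *)

Definition no_consecutive_ones (w : nat -> bool) : Prop := forall i, w i -> ~~ w i.+1.

Lemma nseqSr (T : Type) n (a : T) : nseq n.+1 a = rcons (nseq n a) a.
Proof. by rewrite -cats1 -addn1 nseqD. Qed.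

(** After such a word, an appended run of zeros is the whole final run, so its length can be read
    off. *)
Definition empty_or_ends_in_one (y : seq bool) : Prop :=
  y = [::] \/ exists y', y = rcons y' true.

Lemma suffix_nseq_cat_nseq j r y :
  empty_or_ends_in_one y -> suffix (nseq j false) (y ++ nseq r false) -> j <= r.
Proof.
move=> yP; elim: j r => // j IHj [|r]; last first.
  by rewrite !nseqSr -rcons_cat suffix_rcons eqxx; exact: IHj.
rewrite nseqSr cats0; case: yP => [->|[y' ->]]; last by rewrite suffix_rcons.
by rewrite suffixs0; case: (nseq j false).
Qed.

Lemma suffix_cat_nseq j r v y :
    empty_or_ends_in_one y ->
    suffix (rcons v true ++ nseq j false) (y ++ nseq r false) ->
  j = r /\ suffix (rcons v true) y.
Proof.
move=> yP; elim: j r => [|j IHj] [|r].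
- by rewrite !cats0.
- by rewrite nseqSr -rcons_cat cats0 suffix_rcons.
- rewrite nseqSr -rcons_cat cats0; case: yP => [->|[y' ->]].
    by rewrite suffixs0 -size_eq0 size_rcons.
  by rewrite suffix_rcons.
- by rewrite !nseqSr -!rcons_cat suffix_rcons eqxx => /IHj[-> ?].
Qed.

Lemma nseq_or_last_one (u : seq bool) :
  u = nseq (size u) false \/ exists v j, u = rcons v true ++ nseq j false.
Proof.
elim/last_ind: u => [|u [] IHu]; first by left.
  by right; exists u, 0; rewrite cats0.
case: IHu => [->|[v [j ->]]].
  by left; rewrite size_rcons !size_nseq nseqSr.
by right; exists v, j.+1; rewrite nseqSr rcons_cat.
Qed.

(** * Right special factors under the first dual substitution *)

Section DualSubstitution.
Variables (N : nat) (d : nat -> nat).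
Hypothesis N_gt0 : 0 < N.
Let s := dual_sigma N d 1.

Let size_s a : 0 < size (s a). Proof. exact: dual_sigma_gt0. Qed.

Let last_s a c : last c (s a) = ~~ a.
Proof.
case: a; rewrite /s /= ?last_rcons//.
by rewrite -(prednK N_gt0) nseqSr last_rcons.
Qed.

Section Blocks.
Variable w : nat -> bool.
Hypothesis w11 : no_consecutive_ones w.

(** The number of zeros that follow the image of the first [q] letters before the next 1. *)
Let run q := if w q then N + d 1 else d 1.

(* The block of zeros coming from a letter 1 merges with the zeros of the block
   of the 0 that follows it. *)
Lemma subst_word_run q : exists q', [/\ 0 < q', w q'.-1 = false &
  subst_word s (mkseq w q') = subst_word s (mkseq w q) ++ rcons (nseq (run q) false) true].
Proof.
rewrite /run; case: ifP => wq.
  have /negbTE wq1 := w11 wq; exists q.+2; split=> //.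
  rewrite !mkseqSr !subst_word_rcons wq wq1 /s /= -catA; congr (_ ++ _).
  by rewrite nseqD rcons_cat.
by exists q.+1; split=> //; rewrite mkseqSr subst_word_rcons wq.
Qed.

Lemma mkseq_subst_run q r : r <= run q ->
  let m := size (subst_word s (mkseq w q)) + r in
  mkseq (subst_inf s w) m = subst_word s (mkseq w q) ++ nseq r false /\
  subst_inf s w m = (r == run q).
Proof.
move=> rL; have [q' [_ _]] := subst_word_run q.
have := mkseq_subst_inf w q' size_s; move: (run q) rL => L rL E Eq'; rewrite {}Eq' in E.
rewrite -[r in _ + r](size_nseq r false) -size_cat.
have [t tE] : exists t, rcons (nseq L false) true = nseq r false ++ (r == L) :: t.
  move: rL; rewrite leq_eqVlt => /orP[/eqP->|rL].
    by exists [::]; rewrite eqxx cats1.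
  exists (rcons (nseq (L - r.+1) false) true); rewrite ltn_eqF//.
  by rewrite -rcons_cons -rcons_cat -[false :: _]/(nseq (L - r.+1).+1 false) -nseqD subnSK// subnKC// ltnW.
by move: E; rewrite tE catA; exact: mkseq_cat_cons.
Qed.

(** Each position falls in a run of zeros or on the 1 closing it. Starting the run only at [q = 0]
    or after a letter 0 ensures that the image before it is empty or ends in 1. *)
Lemma subst_inf_parse m : exists q r, [/\ r <= run q, (q == 0) || ~~ w q.-1 &
  m = size (subst_word s (mkseq w q)) + r].
Proof.
elim: m => [|m [q [r [rL q0 ->]]]]; first by exists 0, 0.
move: rL; rewrite leq_eqVlt => /orP[/eqP->|rL]; last by exists q, r.+1; split; rewrite ?addnS.
have [q' [q'0 wq' E]] := subst_word_run q; exists q', 0.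
by rewrite E wq' orbT; split=> //; rewrite size_cat size_rcons size_nseq addn0 addnS.
Qed.

Lemma subst_word_mkseq_ends_in_one q : (q == 0) || ~~ w q.-1 ->
  empty_or_ends_in_one (subst_word s (mkseq w q)).
Proof.
case: q => [|q] /=; first by left.
move=> /negbTE wq; right; rewrite mkseqSr subst_word_rcons wq -rcons_cat.
by eexists.
Qed.

Lemma right_special_subst z : right_special w z ->
  right_special (subst_inf s w) (subst_word s z ++ nseq (d 1) false).
Proof.
(* The letters swap: after [z], a 0 gives a run of exactly [d 1] zeros and then a 1, while a 1 gives
   a longer run, hence one more 0. *)
move=> zR a; have /is_factor_rconsP[q zq wq] := zR (~~ a).
have rL : d 1 <= run q by rewrite /run; case: ifP => // _; exact: leq_addl.
have [E1 E2] := mkseq_subst_run rL; apply/is_factor_rconsP.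
exists (size (subst_word s (mkseq w q)) + d 1).
  by rewrite E1 suffix_catl// eqxx suffix_subst_word.
by rewrite E2 /run wq; case: a {zR wq} => /=; rewrite ?eqxx// -[X in X == _]add0n eqn_add2r ltn_eqF.
Qed.

(** An occurrence followed by 0 stops strictly inside a run, and one followed by 1 stops at its end.
    If [u] contains a 1, both occurrences have the same final run; this forces its length to be
    [d 1], with a letter 1 at [q0] and a 0 at [q1]. The common suffix of the two preimages is then
    right special. *)
Lemma right_special_desubst u : 0 < d 1 -> right_special (subst_inf s w) u ->
  suffix u (nseq (N.-1 + d 1) false) \/
  exists z, [/\ right_special w z, size z < size u &
    suffix u (subst_word s z ++ nseq (d 1) false)].
Proof.
move=> d0 uR.
have uP a : exists q r, [/\ r <= run q, a = (r == run q),
    empty_or_ends_in_one (subst_word s (mkseq w q)) &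
    suffix u (subst_word s (mkseq w q) ++ nseq r false)].
  have /is_factor_rconsP[m um wm] := uR a.
  have [q [r [rL q0 mE]]] := subst_inf_parse m; exists q, r.
  have [E1 E2] := mkseq_subst_run rL; rewrite -E1 -E2 -mE; split=> //.
  exact: subst_word_mkseq_ends_in_one.
have [q0 [r0 [rL0 re0 end0 u0]]] := uP false.
have [q1 [r1 [rL1 re1 end1 u1]]] := uP true.
have {rL0} {}re0 : r0 < run q0 by rewrite ltn_neqAle -re0.
have {rL1} {}re1 : r1 = run q1 by apply/eqP; rewrite -re1.
have [uE|[v [j uE]]] := nseq_or_last_one u; rewrite uE in u0 u1 *.
  (* The longest run has [N + d 1] zeros, and one of them must remain after [u]. *)
  left; have jr := suffix_nseq_cat_nseq end0 u0.
  have jL : size u <= N.-1 + d 1 by move: re0; rewrite /run; case: ifP; lia.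
  by rewrite -(subnK jL) nseqD suffix_suffix.
right; have [j0 v0] := suffix_cat_nseq end0 u0; have [j1 v1] := suffix_cat_nseq end1 u1.
have [jd wq0 wq1] : [/\ j = d 1, w q0 = true & w q1 = false].
  by move: re0 re1; rewrite /run; do 2 case: ifP; split => //; lia.
have [z [z0 z1 vz zv]] := common_suffix_subst size_s last_s v0 v1.
exists z; split.
- by case; apply/is_factor_rconsP; [exists q0|exists q1].
- by rewrite size_cat size_nseq jd -addn1 leq_add.
- by rewrite jd suffix_catl// eqxx.
Qed.

End Blocks.
End DualSubstitution.

(** * Desubstitution of dual sequences, which shifts the digits *)

Lemma is_dual_seq_desubst N d w : is_dual_seq N d w ->
  exists2 w', is_dual_seq N (fun n => d n.+1) w' & w = subst_inf (dual_sigma N d 1) w'.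
Proof.
case=> W [<- WP]; exists (W 2); last exact: WP.
by exists (fun n => W n.+1); split=> // n _; exact: WP.
Qed.

Lemma dual_seq_no_consecutive_ones N d w : 0 < N -> (forall n, 0 < n -> 0 < d n) ->
  is_dual_seq N d w -> no_consecutive_ones w.
Proof.
move=> N0 d0 /is_dual_seq_desubst[w' _ ->].
set s := dual_sigma N d 1; have s0 a : 0 < size (s a) by exact: dual_sigma_gt0.
pose e a b := ~~ (a && b).
have e0 m : path e false (nseq m false) by elim: m.
(* The starting letter [b] is arbitrary because both blocks begin with 0. *)
have sP P b : path e b (subst_word s P).
  elim: P b => //= a P IHP b; rewrite /subst_word /= cat_path IHP andbT.
  case: a; first by rewrite /= -(prednK N0) /= /e andbF e0.
  rewrite rcons_path; case: (d 1) (d0 1 isT) => //= m _.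
  rewrite [e b _]/e andbF e0 /=; suff -> : last false (nseq m false) = false by [].
  by elim: m.
move=> i; pose P := subst_word s (mkseq w' i.+2).
have iP : i.+1 < size P by apply: leq_trans (size_subst_word _ s0); rewrite size_mkseq.
rewrite !(@nth_subst_inf _ _ i.+2)// 1?ltnW// -/P => wi.
by have /(pathP false)/(_ _ iP) := sP (mkseq w' i.+2) false; rewrite -/P /= /e wi.
Qed.

(** * The words [dual_Sigma], [dual_S] and [dual_T] under a shift of the digits *)

Lemma size_pow_word m w : size (pow_word m w) = m * size w.
Proof. by elim: m => //= m IHm; rewrite /pow_word /= size_cat IHm mulSn. Qed.

Lemma pow_word_rcons m w a : exists v, pow_word m.+1 (rcons w a) = rcons v a.
Proof.
elim: m => [|m [v vE]]; first by exists w; rewrite /pow_word /= cats0.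
by exists (rcons w a ++ v); rewrite rcons_cat -vE.
Qed.

Section DualWords.
Variable N : nat.

Lemma dual_sigma_comp_cat d n u v : dual_sigma_comp N d n (u ++ v) =
  dual_sigma_comp N d n u ++ dual_sigma_comp N d n v.
Proof. by elim: n u v => //= n IHn u v; rewrite subst_word_cat IHn. Qed.

(** The definition peels off the innermost substitution; desubstitution requires peeling off the
    outermost one. *)
Lemma dual_sigma_compSl d n w : dual_sigma_comp N d n.+1 w =
  subst_word (dual_sigma N d 1) (dual_sigma_comp N (fun n => d n.+1) n w).
Proof. by elim: n w => // n IHn w; rewrite -IHn. Qed.

Lemma dual_Sigma_shift d k : dual_Sigma N d k.+2 =
  subst_word (dual_sigma N d 1) (dual_Sigma N (fun n => d n.+1) k.+1).
Proof. exact: dual_sigma_compSl. Qed.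

(** Every power in the product except the last, which is a run of [d 1] zeros, is an image under the
    first substitution. *)
Lemma dual_S_shift d k : dual_S N d k.+1 =
  subst_word (dual_sigma N d 1) (dual_S N (fun n => d n.+1) k) ++ nseq (d 1) false.
Proof.
elim: k => [|k IHk].
  by rewrite /= cats0 /dual_Sigma /=; elim: (d 1) => //= m; rewrite /pow_word /= => ->.
have SE e m : dual_S N e m.+1 = pow_word (e m.+1) (dual_Sigma N e m.+1) ++ dual_S N e m by [].
by rewrite SE IHk [in RHS]SE subst_word_cat subst_word_pow -dual_Sigma_shift catA.
Qed.

Lemma dual_T_shift d k : dual_T N d k.+2 =
  subst_word (dual_sigma N d 1) (dual_T N (fun n => d n.+1) k.+1) ++ nseq (d 1) false.
Proof.
by rewrite /dual_T subst_word_cat subst_word_pow -dual_Sigma_shift -catA -dual_S_shift.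
Qed.

Lemma dual_T1 d : dual_T N d 1 = nseq (N.-1 + d 1) false.
Proof.
rewrite /dual_T dual_S_shift /= nseqD; congr (_ ++ _).
by rewrite /dual_Sigma /=; elim: (N.-1) => //= m; rewrite /pow_word /= => ->.
Qed.

Lemma suffix_dual_S d j k : j <= k -> suffix (dual_S N d j) (dual_S N d k).
Proof.
elim: k => [|k IHk]; first by rewrite leqn0 => /eqP->; exact: suffix_refl.
rewrite leq_eqVlt => /orP[/eqP->|]; first exact: suffix_refl.
by rewrite ltnS => /IHk; exact: suffix_catr.
Qed.

(** * Classification of the right special factors *)

Hypothesis N_gt0 : 0 < N.

(** One direction is by induction on the length of [u], the other by induction on [k]; both
    generalize over [d] and [w], since each desubstitution shifts the digits. *)
Lemma right_special_dual d w u : (forall n, 0 < n -> 0 < d n) -> is_dual_seq N d w ->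
  right_special w u <-> exists2 k, 0 < k & suffix u (dual_T N d k).
Proof.
move=> d0 wP; split.
  have [n] := ubnP (size u); elim: n => // n IHn in d d0 w wP u *.
  have [w' w'P ->] := is_dual_seq_desubst wP; rewrite ltnS => un.
  have d0' k : 0 < k -> 0 < d k.+1 by move=> _; exact: d0.
  have w'11 := dual_seq_no_consecutive_ones N_gt0 d0' w'P.
  move=> /(right_special_desubst N_gt0 w'11 (d0 1 isT))[uT|[z [zR zu uz]]].
    by exists 1; rewrite ?dual_T1.
  have [|[|k] // _ zT] := IHn _ d0' _ w'P z _ zR; first exact: leq_trans un.
  exists k.+2; rewrite ?dual_T_shift//; apply: suffix_trans uz _.
  by rewrite suffix_catl// eqxx suffix_subst_word.
case=> k + uT; move/right_special_suffix: uT => uT; case: k uT => // k uT _; apply: uT.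
elim: k => [|k IHk] in d d0 w wP *.
  have [w' w'P ->] := is_dual_seq_desubst wP.
  have d0' k : 0 < k -> 0 < d k.+1 by move=> _; exact: d0.
  have w'11 := dual_seq_no_consecutive_ones N_gt0 d0' w'P.
  (* The sequence [w'] is itself an image, so its first run of zeros is closed by a 1. *)
  have [q w'q] : exists q, w' q = true.
    have [w2 w2P ->] := is_dual_seq_desubst w'P.
    have w211 := dual_seq_no_consecutive_ones N_gt0 (fun k _ => d0' k.+1 isT) w2P.
    have [_ E] := mkseq_subst_run (d := fun k => d k.+1) N_gt0 w211 (leqnn (if w2 0 then _ else _)).
    by rewrite eqxx in E; eexists; exact: E.
  rewrite dual_T1 => a; apply/is_factor_rconsP.
  (* In the run of [N + d 1] zeros coming from that 1, stopping at the end gives the extension by 1,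
     and stopping one letter earlier gives the extension by 0. *)
  pose r := if a then N + d 1 else N.-1 + d 1.
  have rL : r <= if w' q then N + d 1 else d 1.
    by rewrite /r w'q; case: ifP => // _; rewrite leq_add2r leq_pred.
  have [E1 E2] := mkseq_subst_run N_gt0 w'11 rL.
  exists (size (subst_word (dual_sigma N d 1) (mkseq w' q)) + r).
    rewrite E1; apply: suffix_catr; rewrite /r; case: (a); last exact: suffix_refl.
    by rewrite -[in N + _](prednK N_gt0) addSn suffix_cons.
  by rewrite E2 w'q /r; case: (a); rewrite ?eqxx// eqn_add2r; apply/negbTE; lia.
have [w' w'P ->] := is_dual_seq_desubst wP.
have d0' i : 0 < i -> 0 < d i.+1 by move=> _; exact: d0.
rewrite dual_T_shift; apply: right_special_subst => //; last exact: IHk.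
exact: dual_seq_no_consecutive_ones w'P.
Qed.

(** * Last letters and lengths *)

Lemma dual_sigma_rcons d n a : exists v, dual_sigma N d n a = rcons v (~~ a).
Proof.
case: a; last by eexists.
by exists (nseq N.-1 false); rewrite -nseqSr prednK.
Qed.

(** Each substitution flips the last letter, so only the parity of [n] matters. *)
Lemma dual_sigma_comp_rcons d n u a :
  exists v, dual_sigma_comp N d n (rcons u a) = rcons v (odd n (+) a).
Proof.
elim: n u a => [|n IHn] u a; first by exists u; rewrite addFb.
have [b bE] := dual_sigma_rcons d n.+1 a.
have [v vE] := IHn (subst_word (dual_sigma N d n.+1) u ++ b) (~~ a).
by exists v; rewrite /= subst_word_rcons bE -rcons_cat vE addbN addNb.
Qed.

Lemma dual_Sigma_rcons d k : exists v, dual_Sigma N d k.+1 = rcons v (odd k).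
Proof. by rewrite -[odd k]addbF; exact: (dual_sigma_comp_rcons d k [::] false). Qed.

Variable d : nat -> nat.
Hypothesis d_geN : forall n, 0 < n -> N <= d n.

Let d_gt0 n : 0 < n -> 0 < d n. Proof. by move/d_geN; exact: leq_trans. Qed.

(** The block of 0 begins with 0 when its digit is positive, so each [dual_Sigma] is a prefix of the
    next. *)
Lemma size_dual_SigmaS k : 0 < k -> 0 < size (dual_Sigma N d k) <= size (dual_Sigma N d k.+1).
Proof.
case: k => // k _; apply/andP; split.
  by have [v ->] := dual_Sigma_rcons d k; rewrite size_rcons.
rewrite /dual_Sigma /= /subst_word /= cats0.
case: (d k.+1) (d_gt0 (ltn0Sn k)) => // m _.
by rewrite -[rcons _ _]/([:: false] ++ rcons (nseq m false) true) dual_sigma_comp_cat size_cat leq_addr.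
Qed.

Lemma dual_sS k : dual_s N d k.+1 = d k.+1 * size (dual_Sigma N d k.+1) + dual_s N d k.
Proof. by rewrite -size_pow_word -size_cat. Qed.

Lemma dual_tS k :
  dual_t N d k.+1 = N.-1 * size (dual_Sigma N d k.+1) + dual_s N d k.+1.
Proof. by rewrite -size_pow_word -size_cat. Qed.

Lemma dual_s_le_t k : dual_s N d k <= dual_t N d k.
Proof. by case: k => // k; rewrite dual_tS leq_addl. Qed.

(** Both sides exceed [dual_s N d k] by multiples of lengths of [dual_Sigma]; for positive [k] one
    compares [N.-1 < N <= d k.+1] and uses that these lengths do not decrease. *)
Lemma dual_t_lt_s k : dual_t N d k < dual_s N d k.+1.
Proof.
rewrite dual_sS; case: k => [|k]; first by rewrite addn0 muln_gt0 d_gt0.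
rewrite dual_tS ltn_add2r.
have /andP[k0 kS] := size_dual_SigmaS (ltn0Sn k).
apply: leq_trans (leq_mul (d_geN (ltn0Sn _)) kS).
by rewrite ltn_mul2r k0 ltn_predL.
Qed.

Lemma leq_dual_t j k : j <= k -> dual_t N d j <= dual_t N d k.
Proof.
move: j k; apply: (homo_leq leqnn leq_trans) => i.
exact: leq_trans (ltnW (dual_t_lt_s i)) (dual_s_le_t _).
Qed.

Lemma dual_t_ge k : k <= dual_t N d k.
Proof.
elim: k => // k IHk; apply: leq_trans (dual_s_le_t _).
exact: leq_ltn_trans IHk (dual_t_lt_s k).
Qed.

(* Sigma_k and Sigma_{k+1} end with different letters. *)
Lemma dual_T_S_branch k : 0 < k -> 1 < N -> exists a,
  suffix (a :: dual_S N d k) (dual_T N d k) /\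
  suffix (~~ a :: dual_S N d k) (dual_S N d k.+1).
Proof.
case: k N_gt0 => // k _ _ N1; exists (odd k); split.
  have [v vE] := dual_Sigma_rcons d k; rewrite /dual_T vE.
  case: N N1 => [|[|m]] // _ in vE *.
  by have [v' ->] := pow_word_rcons m v (odd k); rewrite cat_rcons suffix_suffix.
have [v vE] := dual_Sigma_rcons d k.+1; rewrite [dual_S N d k.+2]/= -/(dual_S N d k.+1) vE.
case: (d k.+2) (d_gt0 (ltn0Sn k.+1)) => // m _.
by have [v' ->] := pow_word_rcons m v (odd k.+1); rewrite cat_rcons suffix_suffix.
Qed.

(** * Counting the right special factors of a given length *)

Variable w : nat -> bool.
Hypothesis wP : is_dual_seq N d w.

(** The words [dual_T] of level at most [k] are too short to have [u] as a suffix. *)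
Lemma right_special_dual_gt k (u : seq bool) : dual_t N d k < size u ->
  right_special w u <-> exists2 j, k < j & suffix u (dual_T N d j).
Proof.
move=> ku; rewrite (right_special_dual _ d_gt0 wP); split=> -[j j0 uj].
  exists j => //; rewrite ltnNge; apply/negP => jk.
  have := leq_trans ku (size_suffix uj); case: j j0 jk {uj} => // j _ jk.
  by rewrite ltnNge (leq_dual_t jk).
by exists j => //; exact: leq_ltn_trans j0.
Qed.

Lemma suffix_dual_T_S j k (u : seq bool) : 0 < k <= j -> size u <= dual_s N d k ->
  suffix u (dual_T N d j) = suffix u (dual_S N d k).
Proof.
case/andP=> k0 kj uk; have kT : suffix (dual_S N d k) (dual_T N d j).
  exact: suffix_trans (suffix_dual_S d kj) (suffix_suffix _ _).
apply/idP/idP => [uT|uS]; first exact: suffix_total uT kT uk.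
exact: suffix_trans kT.
Qed.

(** Only levels [j >= k] are long enough, and all those words end with [dual_S N d k], which leaves
    a single suffix of length [n]. *)
Lemma card_right_special1 k n : 0 < k -> dual_t N d k.-1 < n <= dual_s N d k ->
  #|[set u : n.-tuple bool | `[< right_special w u >]]| = 1.
Proof.
case: k => // k _ /andP[kn nk]; have [u0 u0S] := suffix_tuple nk.
apply/eqP/cards1P; exists u0; apply/setP => u; rewrite !inE.
have uE : size u = n by rewrite size_tuple.
apply/asboolP/eqP => [|->].
  rewrite (@right_special_dual_gt k) ?uE// => -[j jk].
  rewrite (@suffix_dual_T_S _ k.+1) ?uE// => uS.
  by apply/val_inj/(suffix_eq uS u0S); rewrite !size_tuple.
rewrite (@right_special_dual_gt k) ?size_tuple//; exists k.+1 => //.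
exact: suffix_trans u0S (suffix_suffix _ _).
Qed.

(** Level [k] contributes a suffix of [dual_T N d k]. All higher levels contribute the same suffix
    of [dual_S N d k.+1], which is long enough since [t_k < s_{k+1}]. *)
Lemma card_right_special2 k n : 0 < k -> dual_s N d k < n <= dual_t N d k ->
  #|[set u : n.-tuple bool | `[< right_special w u >]]| = 2.
Proof.
case: k => // k _ /andP[kn nk]; have [u0 u0T] : exists u : n.-tuple bool, suffix u (dual_T N d k.+1).
  exact: suffix_tuple nk.
have nS : n <= dual_s N d k.+2 by exact/ltnW/(leq_ltn_trans nk)/dual_t_lt_s.
have [u1 u1S] := suffix_tuple nS.
(* For [N = 1] the two bounds on [n] would coincide. *)
have N1 : 1 < N.
  rewrite ltnNge; apply/negP => N1; have /negP[] : ~~ (dual_s N d k.+1 < dual_t N d k.+1).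
    by rewrite -leqNgt dual_tS (_ : N.-1 = 0)//; lia.
  exact: leq_trans nk.
have u01 : u0 != u1.
  (* As [n] exceeds the length of the shared [dual_S], equal words would have to agree on the letter
     just before it, where the two branches differ. *)
  have [a [aT aS]] := dual_T_S_branch (ltn0Sn k) N1.
  apply/eqP => uE; rewrite -uE in u1S.
  have au := suffix_total aT u0T; have nau := suffix_total aS u1S.
  have := suffix_eq (au _) (nau _) erefl; rewrite /= size_tuple => /(_ kn kn)[].
  by case: (a).
have <- : #|[set u0; u1]%SET| = 2 by rewrite cards2 u01.
congr #|pred_of_set _|; apply/setP => u; rewrite !inE.
have tn : dual_t N d k < n by exact: leq_trans (dual_t_lt_s k) (ltnW kn).
have uE : size u = n by rewrite size_tuple.
apply/asboolP/orP => [|[]/eqP->].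
- rewrite (@right_special_dual_gt k) ?uE// => -[j]; rewrite leq_eqVlt => /orP[/eqP<- uT|jk].
    by left; apply/eqP/val_inj/(suffix_eq uT u0T); rewrite !size_tuple.
  rewrite (@suffix_dual_T_S _ k.+2) ?uE// => uS.
  by right; apply/eqP/val_inj/(suffix_eq uS u1S); rewrite !size_tuple.
- by rewrite (@right_special_dual_gt k) ?size_tuple//; exists k.+1.
- rewrite (@right_special_dual_gt k) ?size_tuple//; exists k.+2 => //.
  exact: suffix_trans u1S (suffix_suffix _ _).
Qed.

(** The level is the least [k] with [n <= t_k]; it is positive because [t_0 = 0], and minimality
    gives [t_{k-1} < n]. *)
Lemma dual_st_cover n : 0 < n -> exists2 k, 0 < k &
  (dual_t N d k.-1 < n <= dual_s N d k) || (dual_s N d k < n <= dual_t N d k).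
Proof.
move=> n0; have nP : exists k, n <= dual_t N d k by exists n; exact: dual_t_ge.
have [[|k] nk kmin] := ex_minnP nP; first by case: n n0 nk {nP kmin}.
have tk : dual_t N d k < n by rewrite ltnNge; apply/negP => /kmin; rewrite ltnn.
by exists k.+1 => //; rewrite tk nk andbT /=; case: leqP.
Qed.

End DualWords.

Local Open Scope ring_scope.
Unset Implicit Arguments.

Theorem lemma5p12 (R : realType) (N : nat) (x : R)
    (hN : (2 <= N)%N) (hx : 0 <= x <= 1) (hxI : irrational x)
    (n : nat) (hn : (1 <= n)%N) :
  let p := factor_complexity (dual_ncf N x) in
  let s := dual_s N (ncf_digit N x) in
  let t := dual_t N (ncf_digit N x) in
  let case1 := exists2 k, (1 <= k)%N & (t k.-1 < n <= s k)%N in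
  let case2 := exists2 k, (1 <= k)%N & (s k < n <= t k)%N in
  [/\ case1 \/ case2,
      case1 -> (p n.+1)%:Z - (p n)%:Z = 1 &
      case2 -> (p n.+1)%:Z - (p n)%:Z = 2].
Proof.
have N0 : (0 < N)%N by exact: ltnW.
(* The greedy digits are at least [N], which places them under the hypotheses of the counting
   lemmas. *)
have dN k : (0 < k)%N -> (N <= ncf_digit N x k)%N by move=> _; exact: ncf_digit_ge.
have [wP _] := dual_ncfP N0 hx hxI.
move=> p s t case1 case2.
have pS : (p n.+1)%:Z - (p n)%:Z =
    #|[set u : n.-tuple bool | `[< right_special (dual_ncf N x) u >]]|%:Z.
  by rewrite /p factor_complexityS PoszD addrC addKr.
split.
- have [k k0 /orP[nk|nk]] := dual_st_cover N0 dN hn; [left|right]; by exists k.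
- by case=> k k0 nk; rewrite pS (card_right_special1 N0 dN wP k0 nk).
- by case=> k k0 nk; rewrite pS (card_right_special2 N0 dN wP k0 nk).
Qed.
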